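(* Let $S$ be an infinite discrete semigroup and let $p$ be a minimal ultrafilter on $S$. Then there exist a $\Theta$-maximal filter $\mathcal{F}$ and a $\Sigma$-maximal filter $\mathcal{G}$ on $S$ such that $p$ is the ultrafilter generated by $\mathcal{F}\cup\mathcal{G}$. Specifically, if $L$ and $R$ are respectively the minimal left and right ideals of $\beta S$ containing $p$, then $\mathcal{F}=\bigcap L$ and $\mathcal{G}=\bigcap\big(p\cdot E(R)\big)$ are two such filters. Moreover, $\mathcal{F}$ is the only $\Theta$-maximal filter contained in $p$, and $$\mathcal{F}=\{A\in p : s^{-1}A\in p \text{ for all } s\in S\}.$$
   Context: $\beta S$ is the set of ultrafilters on $S$ (principal ultrafilters identified with points of $S$), with the topology whose basic clopen sets are $\overline{A}=\{p\in\beta S: A\in p\}$, $A\subseteq S$. The operation of $S$ extends to $\beta S$ by: $A\in p\cdot q$ iff $\{x\in S: x^{-1}A\in q\}\in p$, where $x^{-1}A=\{y\in S: x\cdot y\in A\}$. This makes $\beta S$ a compact Hausdorff right topological semigroup. $K(\beta S)$ is its smallest two-sided ideal; it is the disjoint union of all minimal left ideals and also of all minimal right ideals. A minimal ultrafilter on $S$ is an element of $K(\beta S)$. $E(R)$ is the set of idempotents in $R$, and $p\cdot E(R)=\{p\cdot e: e\in E(R)\}$. For nonempty $X\subseteq\beta S$, $\bigcap X$ is the filter of all subsets of $S$ that belong to every ultrafilter in $X$. A set $A\subseteq S$ is thick if for every finite nonempty $F\subseteq S$ there is $x\in S$ with $Fx\subseteq A$; $A$ is syndetic if there is a finite nonempty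 $F\subseteq S$ with $S=\bigcup_{s\in F}s^{-1}A$. $\Theta$ and $\Sigma$ denote the families of thick and syndetic subsets of $S$, respectively. A filter $\mathcal{F}$ on $S$ is $\Theta$-maximal if $\mathcal{F}\subseteq\Theta$ and every filter properly extending $\mathcal{F}$ contains some set not in $\Theta$; $\Sigma$-maximal is defined in the same way with $\Sigma$ in place of $\Theta$. *)

(* Defs.v *)
From HB Require Import structures.
From mathcomp Require Import all_boot.
From mathcomp Require Import boolp classical_sets functions cardinality filter.

Set Implicit Arguments.
Unset Strict Implicit.
Unset Printing Implicit Defensive.

Local Open Scope classical_set_scope.

(* [semigroupType] is multiplicative and not assumed commutative. *)
Section Semigroup.
Context {S : semigroupType}.
Implicit Types (A I : set S) (s x e : S).

(* s^-1 A; no inverse of s is involved. *)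
Definition lquot s A : set S := [set y | A (s * y)%g].

(* The factors of F x are s * x with s in F. *)
Definition thick A : Prop :=
  forall F : set S, finite_set F -> F !=set0 ->
    exists x, [set (s * x)%g | s in F] `<=` A.

Definition syndetic A : Prop :=
  exists F : set S, [/\ finite_set F, F !=set0 &
    [set: S] = \bigcup_(s in F) lquot s A].

Definition left_ideal I : Prop :=
  I !=set0 /\ forall s x, I x -> I (s * x)%g.

Definition right_ideal I : Prop :=
  I !=set0 /\ forall s x, I x -> I (x * s)%g.

Definition two_sided_ideal I : Prop := left_ideal I /\ right_ideal I.

Definition minimal_left_ideal I : Prop :=
  left_ideal I /\ forall J, left_ideal J -> J `<=` I -> J = I.

Definition minimal_right_ideal I : Prop :=
  right_ideal I /\ forall J, right_ideal J -> J `<=` I -> J = I.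

Definition idempotents A : set S := [set e | A e /\ (e * e)%g = e].

End Semigroup.

(* The intersection of all two-sided ideals. It is the smallest two-sided
   ideal exactly when it is nonempty, as it is for compact right topological
   semigroups. *)
Definition smallest_ideal {S : semigroupType} : set S :=
  smallest two_sided_ideal set0.

Record beta (S : Type) := Beta {
  usets : set_system S;
  usets_ultra : UltraFilter usets
}.

HB.instance Definition _ (S : Type) := gen_eqMixin (beta S).
HB.instance Definition _ (S : Type) := gen_choiceMixin (beta S).

Lemma beta_eq (S : Type) (p q : beta S) : usets p = usets q -> p = q.
Proof.
case: p q => [p up] [q uq] /= epq; case: _ / epq uq => uq.
by congr Beta; exact: Prop_irrelevance.
Qed.

Section Product.
Context {S : semigroupType}.

Definition beta_mul_sets (p q : beta S) : set_system S :=
  [set A | usets p [set x | usets q (lquot x A)]].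

Lemma beta_mul_ultra (p q : beta S) : UltraFilter (beta_mul_sets p q).
Proof.
case: p q => [p up] [q uq].
have pp : ProperFilter p by exact: ultra_proper.
have pq : ProperFilter q by exact: ultra_proper.
have pF : ProperFilter (beta_mul_sets (Beta up) (Beta uq)).
  split; rewrite /beta_mul_sets /=.
    move=> h; apply: (@filter_not_empty _ p).
    by apply: filterS h => x /=; apply: (@filter_not_empty _ q).
  split=> /=.
  - rewrite /beta_mul_sets /=.
    by apply: (@filterS _ p _ setT) => [x _ /=|]; exact: filterT.
  - rewrite /beta_mul_sets /= => A B pA pB.
    apply: (@filterS2 _ p _ _ _ _ _ pA pB) => x /= qA qB.
    exact: filterI qA qB.
  - rewrite /beta_mul_sets /= => A B AB; apply: (@filterS _ p) => x /=.
    by apply: (@filterS _ q) => y; exact: AB.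
split=> // G pG FG; rewrite eqEsubset; split=> // A GA.
suff [//|FC] : beta_mul_sets (Beta up) (Beta uq) A
    \/ beta_mul_sets (Beta up) (Beta uq) (~` A).
  exfalso; apply: (@filter_not_empty _ G).
  by rewrite -(setICr A); apply: filterI => //; exact: FG.
rewrite /beta_mul_sets /=.
have [|h] := in_ultra_setVsetC [set x | q (lquot x A)] up; [by left|right].
apply: filterS h => x /= nA.
by have [] := in_ultra_setVsetC (lquot x A) uq.
Qed.

Definition beta_mul (p q : beta S) : beta S := Beta (beta_mul_ultra p q).

Lemma beta_mulA : associative beta_mul.
Proof.
move=> p q r; apply: beta_eq; rewrite /= /beta_mul_sets /=.
rewrite funeqE => A /=; congr (usets p _); rewrite funeqE => x /=.
congr (usets q _); rewrite funeqE => y /=.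
congr (usets r _); rewrite funeqE => z /=.
by rewrite /lquot /= mulgA.
Qed.

End Product.

HB.instance Definition _ (S : semigroupType) :=
  isSemigroup.Build (beta S) (@beta_mulA S).

Definition minimal_ultrafilter (S : semigroupType) (p : beta S) : Prop :=
  smallest_ideal p.

Definition bigcap_ultra (S : Type) (X : set (beta S)) : set_system S :=
  \bigcap_(q in X) usets q.

(* A filter F is [maximal_in C] when it is Theta-maximal for C the family Theta
   of thick sets, Sigma-maximal for C the family Sigma of syndetic sets. *)
Definition maximal_in (S : Type) (C : set_system S) (F : set_system S) : Prop :=
  [/\ ProperFilter F, F `<=` C &
      forall G : set_system S, ProperFilter G -> F `<` G ->
        exists2 A, G A & ~ C A].

Definition Theta_maximal (S : semigroupType) (F : set_system S) : Prop :=
  maximal_in (@thick S) F.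

Definition Sigma_maximal (S : semigroupType) (F : set_system S) : Prop :=
  maximal_in (@syndetic S) F.

Definition generates (S : Type) (B : set_system S) (p : beta S) : Prop :=
  usets p = smallest (@Filter S) B.

(* Main.v *)
Require Import Defs.
From mathcomp Require Import all_boot.
From mathcomp Require Import boolp classical_sets functions cardinality filter.
Local Open Scope classical_set_scope.

(** Proper filters on [S] correspond to nonempty closed sets of ultrafilters:
[F] to [hull F], the ultrafilters above it, and a closed set [C] to [bigcap_ultra C].
Larger filters have smaller hulls, so maximal filters of a given kind correspond
to minimal closed sets.

A proper filter consists of thick sets exactly when its hull contains a left ideal
([left_ideal_thick], [thick_filter_ideal]). Minimal left ideals are closed, so
the Theta-maximal filters are exactly the filters [bigcap_ultra L] with [L] a
minimal left ideal. Since distinct minimal left ideals are disjoint, the only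
such filter below [p] is the one of the minimal left ideal through [p].

A set is syndetic when its complement is not thick, that is, when every minimal
left ideal has a member containing it. A minimal right ideal [R] has one
idempotent [e] in each minimal left ideal [L], so [p * E(R)] picks the point
[p * e] in each of them, and [bigcap_ultra (p * E(R))] consists of syndetic
sets. Conversely, idempotents of [R] satisfy [f * e = e], so that right
translation by [e] maps [p * E(R)] to the point [p * e]. Right translations are
continuous, so the closure of [p * E(R)] is mapped to [p * e] as well; on [L]
the translation by [e] is the identity, so the closure meets [L] only in [p * e]
([closure_transversal_meet]). A proper filter of syndetic sets has in its hull a
point of every minimal left ideal; if it extends [bigcap_ultra (p * E(R))] these
points must be the [p * e], which gives maximality.

Taking for [L] the minimal left ideal through [p], where [p * e = p], the hulls
of the two filters meet only in [p]: together they generate [p].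

What has to be known about the semigroup of ultrafilters is that every left
ideal contains a minimal one and that minimal left ideals contain idempotents.
Both come from compactness and Zorn's lemma on closed sets ([minimal_closed]);
the rest of the ideal theory is algebra. *)

(** * Ideals of a semigroup *)

Section Ideals.
Context {T : semigroupType}.
Implicit Types (I J L R : set T) (e f p r x y : T).

Lemma left_ideal_mulr L x : left_ideal L ->
  left_ideal [set (y * x)%g | y in L].
Proof.
move=> [[y Ly] Lm]; split; first by exists (y * x)%g, y.
move=> s _ [z Lz <-]; exists (s * z)%g; first exact: Lm.
by rewrite mulgA.
Qed.

Lemma left_idealT x : left_ideal [set: T].
Proof. by split=> //; exists x. Qed.

Lemma minimal_left_ideal_unique L L' p :
  minimal_left_ideal L -> minimal_left_ideal L' -> L p -> L' p -> L = L'.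
Proof.
move=> [[_ LI] Lmin] [[_ L'I] L'min] Lp L'p.
have I : left_ideal (L `&` L').
  split; first by exists p.
  by move=> s x [Lx L'x]; split; [exact: LI|exact: L'I].
by rewrite -(Lmin _ I (@subIsetl _ _ _)) (L'min _ I (@subIsetr _ _ _)).
Qed.

Lemma minimal_right_ideal_unique R R' p :
  minimal_right_ideal R -> minimal_right_ideal R' -> R p -> R' p -> R = R'.
Proof.
move=> [[_ RI] Rmin] [[_ R'I] R'min] Rp R'p.
have I : right_ideal (R `&` R').
  split; first by exists p.
  by move=> s x [Rx R'x]; split; [exact: RI|exact: R'I].
by rewrite -(Rmin _ I (@subIsetl _ _ _)) (R'min _ I (@subIsetr _ _ _)).
Qed.

Lemma minimal_left_idealM L x : minimal_left_ideal L -> L x ->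
  [set (y * x)%g | y in L] = L.
Proof.
move=> [LI Lmin] Lx; apply: Lmin; first exact: left_ideal_mulr.
by move=> _ [y Ly <-]; exact: LI.2.
Qed.

Lemma minimal_right_idealM R x : minimal_right_ideal R -> R x ->
  [set (x * y)%g | y in R] = R.
Proof.
move=> [RI Rmin] Rx; apply: Rmin; last by move=> _ [y Ry <-]; exact: RI.2.
split; first by exists (x * x)%g, x.
move=> s _ [z Rz <-]; exists (z * s)%g; first exact: RI.2.
by rewrite mulgA.
Qed.

(** Every element of [L] is some [y * e], which [e] fixes on the right. *)
Lemma idempotent_right_unit L e r :
  minimal_left_ideal L -> idempotents L e -> L r -> (r * e)%g = r.
Proof.
move=> Lm [Le ee]; rewrite -{1}(minimal_left_idealM _ _ Lm Le) => -[y _ <-].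
by rewrite -mulgA ee.
Qed.

Lemma idempotent_left_unit R e r :
  minimal_right_ideal R -> idempotents R e -> R r -> (e * r)%g = r.
Proof.
move=> Rm [Re ee]; rewrite -{1}(minimal_right_idealM _ _ Rm Re) => -[y _ <-].
by rewrite mulgA ee.
Qed.

(** A left ideal inside [L x] pulls back along [y |-> y * x] to a left ideal
inside [L]. *)
Lemma minimal_left_ideal_mulr L x : minimal_left_ideal L ->
  minimal_left_ideal [set (y * x)%g | y in L].
Proof.
move=> [LI Lmin]; split; first exact: left_ideal_mulr.
move=> J [[z Jz] JI] JL; apply/seteqP; split=> // _ [y Ly <-].
have KL : [set y | L y /\ J (y * x)%g] = L.
  apply: Lmin; last by move=> ? [].
  split.
    by have [w Lw wz] := JL _ Jz; exists w; split; rewrite ?wz.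
  move=> s w [Lw Jw]; split; first exact: LI.2.
  by rewrite -mulgA; exact: JI.
by move: Ly; rewrite -{1}KL => -[].
Qed.

Lemma minimal_left_idealsM p q :
  (exists2 L, minimal_left_ideal L & L p) ->
  exists2 L, minimal_left_ideal L & L (p * q)%g.
Proof.
move=> [L Lm Lp]; exists [set (y * q)%g | y in L]; last by exists p.
exact: minimal_left_ideal_mulr.
Qed.

(** The union of the minimal left ideals is a two-sided ideal as soon as it is
nonempty, since [L x] is again a minimal left ideal. *)
Lemma smallest_ideal_minimal_left p :
  (exists L, @minimal_left_ideal T L) -> smallest_ideal p ->
  exists2 L, minimal_left_ideal L & L p.
Proof.
move=> [L0 L0m] Kp.
apply: (Kp [set x | exists2 L, minimal_left_ideal L & L x]); split => //.
have [[x L0x] _] := L0m.1.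
split; split; try by exists x, L0.
- by move=> s y [L Lm Ly]; exists L => //; exact: Lm.1.2.
- by move=> s y; exact: minimal_left_idealsM.
Qed.

(** Inside [L], the equation [z * (e * x * e) = e] can be solved on the left,
and solving it twice shows that left inverses are right inverses; so every
element [x] of [e T] has [x * y = e] for some [y]. *)
Lemma idempotent_minimal_right_ideal L e :
  minimal_left_ideal L -> idempotents L e ->
  minimal_right_ideal [set (e * y)%g | y in [set: T]].
Proof.
move=> Lm [Le ee].
have inv x : exists y, (e * y * e * (e * x * e) = e)%g.
  have Lz : L (e * x * e)%g by exact: Lm.1.2.
  have := Le; rewrite -{1}(minimal_left_idealM _ _ Lm Lz) => -[y _ yE].
  exists y; transitivity (e * (y * (e * x * e)))%g; last by rewrite yE.
  by rewrite !mulgA -(mulgA (e * y)%g e e) ee.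
split.
  split; first by exists e, e.
  by move=> s _ [y _ <-]; exists (y * s)%g => //; rewrite mulgA.
move=> J [[x Jx] JI] JR; apply/seteqP; split=> // _ [t _ <-].
have [y yx] := inv x; have [w wy] := inv y.
have xw : (e * w * e = e * x * e)%g.
  transitivity (e * w * e * (e * y * e * (e * x * e)))%g.
    by rewrite yx -[RHS]mulgA ee.
  by rewrite [LHS]mulgA wy !mulgA ee.
have xy : (e * x * e * (e * y * e) = e)%g by rewrite -xw.
have Jex : J (e * x)%g.
  by have [u _ ux] := JR _ Jx; rewrite -ux mulgA ee ux.
have -> : (e * t = e * x * (e * (e * y * e) * t))%g.
  by rewrite -[in LHS]xy !mulgA.
exact: JI.
Qed.

(** Since [p = p * e], a right ideal inside [p T] pulls back along
[y |-> p * y] to a right ideal inside [e T]. *)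
Lemma minimal_right_ideal_mem L e p :
  minimal_left_ideal L -> idempotents L e -> L p ->
  minimal_right_ideal [set (p * y)%g | y in [set: T]].
Proof.
move=> Lm eL Lp.
have [RI Rmin] := idempotent_minimal_right_ideal _ _ Lm eL.
have pe := idempotent_right_unit _ _ _ Lm eL Lp.
split.
  split; first by exists (p * p)%g, p.
  by move=> s _ [y _ <-]; exists (y * s)%g => //; rewrite mulgA.
move=> J [[x Jx] JI] JR; apply/seteqP; split=> // _ [t _ <-].
have KR : [set y | [set (e * y)%g | y in [set: T]] y /\ J (p * y)%g]
    = [set (e * y)%g | y in [set: T]].
  apply: Rmin; last by move=> ? [].
  split.
    have [u _ ux] := JR _ Jx; exists (e * u)%g; split; first by exists u.
    by rewrite mulgA pe ux.
  move=> s w [Rw Jw]; split; first exact: RI.2.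
  by rewrite mulgA; exact: JI.
have : [set (e * y)%g | y in [set: T]] (e * t)%g by exists t.
by rewrite -KR => -[_]; rewrite mulgA pe.
Qed.

(** For [x] in both ideals and [y] in [L] with [y * x = e], the product [x * y]
is idempotent because [x * e = x]. *)
Lemma idempotent_in_meet R L e :
  right_ideal R -> minimal_left_ideal L -> idempotents L e ->
  exists2 f, idempotents R f & L f.
Proof.
move=> [[u Ru] RI] Lm eL.
have Lx : L (u * e)%g by exact: Lm.1.2 eL.1.
have := eL.1; rewrite -{1}(minimal_left_idealM _ _ Lm Lx) => -[y Ly yx].
exists (u * e * y)%g; last exact: Lm.1.2.
split; first by do 2 apply: (RI).
rewrite mulgA -[X in (X * _)%g]mulgA yx.
by rewrite (idempotent_right_unit _ _ _ Lm eL Lx).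
Qed.

End Ideals.

(** * Closed sets of ultrafilters *)

Section Closed.
Context {S : Type}.
Implicit Types (p q r : beta S) (C D : set (beta S)) (F G : set_system S).

Definition hull F : set (beta S) := [set q | F `<=` usets q].

(** The closed sets of the Stone topology, since the closure of [C] is the set
of ultrafilters containing every set that belongs to all members of [C]. *)
Definition stone_closed C := hull (bigcap_ultra C) `<=` C.

#[local] Instance usets_proper p : ProperFilter (usets p).
Proof. by apply: ultra_proper; exact: usets_ultra. Qed.

Lemma ultra_disjoint p A : usets p A -> ~ usets p (~` A).
Proof.
move=> pA pC; apply: (@filter_not_empty _ (usets p)).
by rewrite -(setICr A); exact: filterI.
Qed.

Lemma ultraVC p A : usets p A \/ usets p (~` A).
Proof. by apply: in_ultra_setVsetC; exact: usets_ultra. Qed.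

Lemma usets_sub_eq p q : usets p `<=` usets q -> p = q.
Proof.
by move=> pq; apply/esym/beta_eq/(@max_filter _ _ (usets_ultra p)).
Qed.

Lemma bigcap_ultra_filter C : Filter (bigcap_ultra C).
Proof.
split=> [q _|A B CA CB q Cq|A B AB CA q Cq].
- exact: filterT.
- by apply: filterI; [exact: CA|exact: CB].
- by apply: filterS AB _; exact: CA.
Qed.

Lemma bigcap_ultra_proper C : C !=set0 -> ProperFilter (bigcap_ultra C).
Proof.
move=> [q Cq]; split; last exact: bigcap_ultra_filter.
by move=> /(_ q Cq); exact: (@filter_not_empty _ (usets q)).
Qed.

Lemma bigcap_ultraS C D : C `<=` D -> bigcap_ultra D `<=` bigcap_ultra C.
Proof. by move=> CD A DA q Cq; exact/DA/CD. Qed.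

Lemma bigcap_ultraN C A : ~ bigcap_ultra C A ->
  exists2 q, C q & usets q (~` A).
Proof.
move=> nA; apply: contrapT => h; apply: nA => q Cq.
by have [//|qA] := ultraVC q A; exfalso; apply: h; exists q.
Qed.

Lemma hull_nonempty F : ProperFilter F -> hull F !=set0.
Proof.
by move=> FF; have [G [GU FG]] := ultraFilterLemma FF; exists (Beta GU).
Qed.

(** The intersections [A `&` B] form a base of a proper filter, which extends to
an ultrafilter. *)
Lemma hull_meet F G : Filter F -> Filter G ->
  (forall A B, F A -> G B -> (A `&` B) !=set0) ->
  exists2 q, hull F q & hull G q.
Proof.
move=> FF GG FG.
pose D : set (set S * set S) := [set AB | F AB.1 /\ G AB.2].
have HH : ProperFilter (filter_from D (fun AB => AB.1 `&` AB.2)).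
  apply: filter_from_proper; last by move=> [A B] [FA GB]; exact: FG.
  apply: filter_from_filter.
    by exists (setT, setT); split; exact: filterT.
  move=> [A B] [A' B'] [/= FA GB] [/= FA' GB'].
  exists (A `&` A', B `&` B'); first by split; exact: filterI.
  by move=> x [[? ?] [? ?]].
have [q qH] := hull_nonempty _ HH; exists q => A ?; apply: qH.
- by exists (A, setT) => [|x []] //; split => //; exact: filterT.
- by exists (setT, A) => [|x []] //; split => //; exact: filterT.
Qed.

(** If [A] is not in [F], every member of [F] meets the complement of [A], so
some ultrafilter above [F] omits [A]. *)
Lemma filter_hull F A : Filter F -> (forall q, hull F q -> usets q A) -> F A.
Proof.
move=> FF FA; apply: contrapT => nFA.
have [q Fq] : exists2 q, hull F q & hull (globally (~` A)) q.
  apply: hull_meet => B C FB gC; apply: contrapT => BC0; apply: nFA.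
  apply: filterS FB => x Bx; apply: contrapT => nAx; apply: BC0.
  by exists x; split=> //; exact: gC.
move=> /(_ (~` A) (fun x => id)); exact: ultra_disjoint (FA q Fq).
Qed.

(** Compactness, for chains: the union of the filters [bigcap_ultra C] over the
members [C] of the chain is a proper filter. *)
Lemma chain_bigcap_nonempty (X : set (set (beta S))) :
  X !=set0 -> total_on X subset ->
  (forall C, X C -> stone_closed C /\ C !=set0) ->
  \bigcap_(C in X) C !=set0.
Proof.
move=> [C0 XC0] Xtot XP.
have UF : ProperFilter (\bigcup_(C in X) bigcap_ultra C).
  split=> [[C XC]|].
    by apply: (@filter_not_empty _ _ (bigcap_ultra_proper _ (XP _ XC).2)).
  split.
  - by exists C0 => // q _; exact: filterT.
  - move=> A B [C XC CA] [D XD DB].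
    have [CD|DC] := Xtot _ _ XC XD.
    + exists C => //; apply: (@filterI _ _ (bigcap_ultra_filter C)) => //.
      exact: bigcap_ultraS CD _ DB.
    + exists D => //; apply: (@filterI _ _ (bigcap_ultra_filter D)) => //.
      exact: bigcap_ultraS DC _ CA.
  - move=> A B AB [C XC CA]; exists C => //.
    exact: (@filterS _ _ (bigcap_ultra_filter C)) AB CA.
have [q qU] := hull_nonempty _ UF; exists q => C XC.
by apply: (XP _ XC).1 => A CA; apply: qU; exists C.
Qed.

Lemma stone_closed_bigcap (X : set (set (beta S))) :
  (forall C, X C -> stone_closed C) -> stone_closed (\bigcap_(C in X) C).
Proof.
move=> XP q h C XC; apply: (XP _ XC) => A CA; apply: h => r rX.
by apply: CA; exact: rX.
Qed.

(** Zorn's lemma for closed sets, ordered by reverse inclusion. It serves both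
for left ideals and for subsemigroups. *)
Lemma minimal_closed (P : set (set (beta S))) C0 :
  (forall X, X `<=` P -> P (\bigcap_(C in X) C)) ->
  stone_closed C0 -> C0 !=set0 -> P C0 ->
  exists M, [/\ M `<=` C0, stone_closed M, M !=set0, P M &
    forall N, N `<=` M -> stone_closed N -> N !=set0 -> P N -> N = M].
Proof.
move=> PI C0c C0n PC0.
pose Q C := [/\ stone_closed C, C !=set0 & P C].
(* Complements turn intersections into unions; intersecting with [C0] makes the
   empty union correspond to [C0]. *)
have [X /= XX|A [/= [Mc Mn PM] Amax]] :=
    @Zorn_bigcup _ [set X | Q (C0 `\` X)].
  move=> Xtot; pose Y := [set C0] `|` [set C0 `\` A | A in X].
  have YQ C : Y C -> Q C by case=> [->|[A XA <-]] //; exact: XX.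
  have -> : C0 `\` \bigcup_(A in X) A = \bigcap_(C in Y) C.
    apply/seteqP; split=> q.
      move=> [C0q Xq] C [->//|[A XA <-]]; split=> // Aq.
      by apply: Xq; exists A.
    move=> Yq; split; first by apply: Yq; left.
    by move=> [A XA Aq]; have [|_] := Yq (C0 `\` A); [right; exists A|exact].
  split.
  - by apply: stone_closed_bigcap => C /YQ [].
  - apply: chain_bigcap_nonempty.
    + by exists C0; left.
    + move=> _ _ [->|[A XA <-]] [->|[B XB <-]].
      * by left.
      * by right; move=> q [].
      * by left; move=> q [].
      * have [AB|BA] := Xtot _ _ XA XB; [right|left] => q [C0q nq];
        by split=> // ?; apply: nq; auto.
    + by move=> C /YQ [].
  - by apply: PI => C /YQ [].
exists (C0 `\` A); split=> // N NM Nc Nn PN.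
apply/seteqP; split=> // q [C0q nAq]; apply: contrapT => nNq.
apply: (Amax (~` N)).
  by split=> [r Ar /NM []//|h]; exact/nAq/h.
rewrite /= /setD/= (_ : [set x | _] = N) //.
apply/seteqP; split=> r; first by move=> [_ /contrapT].
by move=> Nr; split; [exact: (NM _ Nr).1|].
Qed.

End Closed.

#[local] Existing Instance usets_proper.

(** * Minimal left ideals and idempotents of the Stone-Cech compactification *)

Section BetaSemigroup.
Context {S : semigroupType}.
Implicit Types (p q r x : beta S) (C D J L R : set (beta S)).

Definition principal (s : S) : beta S := Beta (principal_filter_ultra s).

Lemma usetsM p q A :
  usets (p * q)%g A = usets p [set x | usets q (lquot x A)].
Proof. by []. Qed.

Lemma principalM s q A : usets (principal s * q)%g A <-> usets q (lquot s A).
Proof. by rewrite usetsM; exact: principal_filterP. Qed.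

(** The right translation [y |-> y * x] is continuous, so it maps closed sets to
closed sets: if [r] is in the closure of [C x], then the filter of [C] meets all
the sets [{y | usets x (lquot y A)}] with [A] in [r]. *)
Lemma stone_closed_mulr C x : stone_closed C ->
  stone_closed [set (c * x)%g | c in C].
Proof.
move=> Cc r rC.
pose B A := [set y | usets x (lquot y A)].
have [||A D CA [A' rA' A'A]|q qC qr] :=
    @hull_meet _ (bigcap_ultra C) (filter_from (usets r) B).
- exact: bigcap_ultra_filter.
- apply: filter_from_filter; first by exists setT; exact: filterT.
  move=> A A' rA rA'; exists (A `&` A'); first exact: filterI.
  by move=> y h; split; apply: filterS h => z [].
- apply: contrapT => AB0; apply: (ultra_disjoint _ _ rA').
  apply: rC => _ [c Cc' <-]; apply: filterS (CA c Cc') => y Ay.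
  have [xA|//] := ultraVC x (lquot y A').
  by exfalso; apply: AB0; exists y; split=> //; exact: A'A.
exists q; first exact: Cc.
by apply/esym/usets_sub_eq => A rA; apply: qr; exists A.
Qed.

Lemma exists_minimal_left_ideal J : left_ideal J ->
  exists L, [/\ minimal_left_ideal L, stone_closed L & L `<=` J].
Proof.
move=> [[x Jx] JI].
have [||||M [MC Mc Mn MI Mmin]] := @minimal_closed S
    [set D | forall s y : beta S, D y -> D (s * y)%g]
    [set (y * x)%g | y in [set: beta S]].
- by move=> X XP s y Xy C XC; apply: (XP _ XC); exact: Xy.
- exact: stone_closed_mulr.
- by exists (x * x)%g, x.
- by move=> s _ [y _ <-]; exists (s * y)%g => //; rewrite mulgA.
(* Any left ideal inside [M] contains the closed left ideal generated by one of
   its elements, so it is enough that [M] is minimal among the closed ones. *)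
exists M; split=> //; last by move=> _ /MC [y _ <-]; exact: JI.
split=> // I [[y Iy] II] IM; apply/seteqP; split=> //.
rewrite -(Mmin [set (s * y)%g | s in [set: beta S]]).
- by move=> _ [s _ <-]; exact: II.
- by move=> _ [s _ <-]; exact/MI/IM.
- exact: stone_closed_mulr.
- by exists (y * y)%g, y.
- by move=> s _ [t _ <-]; exists (s * t)%g => //; rewrite mulgA.
Qed.

Lemma minimal_left_ideal_closed L : minimal_left_ideal L -> stone_closed L.
Proof.
move=> Lm; have [L' [[L'I _] L'c L'L]] := exists_minimal_left_ideal _ Lm.1.
by rewrite -(Lm.2 _ L'I L'L).
Qed.

(** The Ellis-Numakura lemma: if [M] is a minimal closed subsemigroup and [x] is
in [M], then [M x] is one as well, so [M x = M] contains [x]; hence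
[{y in M | y * x = x}] is a closed subsemigroup too, and it contains [x]. *)
Lemma exists_idempotent C : stone_closed C -> C !=set0 ->
  (forall y z : beta S, C y -> C z -> C (y * z)%g) -> idempotents C !=set0.
Proof.
move=> Cc Cn CM.
have [|M [MC Mc [x Mx] MM Mmin]] := @minimal_closed S
    [set D | forall y z : beta S, D y -> D z -> D (y * z)%g] C _ Cc Cn CM.
  move=> X XP y z Xy Xz D XD.
  by apply: (XP _ XD); [exact: Xy|exact: Xz].
have MxE : [set (y * x)%g | y in M] = M.
  apply: Mmin; last 1 first.
  - move=> _ _ [y My <-] [z Mz <-]; exists (y * x * z)%g; last first.
      by rewrite !mulgA.
    by do 2 apply: (MM) => //.
  - by move=> _ [y My <-]; exact: MM.
  - exact: stone_closed_mulr.
  - by exists (x * x)%g, x.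
exists x; split; first exact: MC.
suff : [set y | M y /\ (y * x)%g = x] x by case.
rewrite (Mmin [set y | M y /\ (y * x)%g = x]) //.
- by move=> y [].
- move=> r h; split.
    by apply: Mc => A MA; apply: h => y [My _]; exact: MA.
  apply/esym/usets_sub_eq => A xA; rewrite usetsM; apply: h => y [_ yx].
  by move: xA; rewrite -{1}yx usetsM.
- by move: (Mx); rewrite -{1}MxE => -[y My yx]; exists y.
- move=> y z [My yx] [Mz zx]; split; first exact: MM.
  by rewrite -mulgA zx.
Qed.

Lemma minimal_left_ideal_idempotent L : minimal_left_ideal L ->
  idempotents L !=set0.
Proof.
move=> Lm; apply: exists_idempotent.
- exact: minimal_left_ideal_closed.
- exact: Lm.1.1.
- by move=> y z _ Lz; exact: Lm.1.2.
Qed.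

(** * Thick sets and minimal left ideals *)

Lemma left_ideal_thick J : left_ideal J -> bigcap_ultra J `<=` @thick S.
Proof.
move=> [[q Jq] JI] A JA F Ff _.
have : usets q (\bigcap_(s in F) lquot s A).
  have [G ->] := (@finite_fsetP {classic S} F).1 Ff.
  apply: (@filter_bigI S {classic S} G (fun s => lquot s A) (usets q)) => s _.
  apply/principalM.
  by apply: JA; exact: JI.
move=> /filter_ex [x Fx]; exists x => _ [s Fs <-]; exact: Fx.
Qed.

(** The sets [{x | F x `<=` A}], for [A] in [H] and [F] finite, generate a
proper filter. For any ultrafilter [q] above it, [A] belongs to [s * q] for all
points [s] of [S], hence to [t * q] for all ultrafilters [t]. *)
Lemma thick_filter_ideal (H : set_system S) : ProperFilter H ->
  H `<=` @thick S -> exists2 L, minimal_left_ideal L & L `<=` hull H.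
Proof.
move=> HH Hthick.
pose D : set (set S * set S) :=
  [set FA | [/\ finite_set FA.1, FA.1 !=set0 & H FA.2]].
pose B FA : set S := [set x | [set (s * x)%g | s in FA.1] `<=` FA.2].
have [s0 _] : [set: S] !=set0 by apply: (@filter_ex _ H); exact: filterT.
have BF : ProperFilter (filter_from D B).
  apply: filter_from_proper.
    apply: filter_from_filter.
      by exists ([set s0], setT); split=> //=; [exists s0|exact: filterT].
    move=> [F A] [F' A'] [/= Ff Fn HA] [/= F'f F'n HA'].
    exists (F `|` F', A `&` A').
      split=> /=; [by rewrite finite_setU| |exact: filterI].
      by have [s Fs] := Fn; exists s; left.
    move=> x h; split=> _ [s Fs <-].
      by have [] : (A `&` A') (s * x)%g by apply: h; exists s => //; left.
    by have [] : (A `&` A') (s * x)%g by apply: h; exists s => //; right.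
  by move=> [F A] [/= Ff Fn HA]; exact: Hthick.
have [q qB] := hull_nonempty _ BF.
have qH (t : beta S) : hull H (t * q)%g.
  move=> A HA; rewrite usetsM; apply: filterS (filterT : usets t setT) => s _.
  apply: qB; exists ([set s], A) => [|x]; first by split=> //=; exists s.
  by apply; exists s.
have [L [Lm _ Lq]] := exists_minimal_left_ideal _
  (left_ideal_mulr _ q (left_idealT q)).
by exists L => // _ /Lq [t _ <-].
Qed.

Lemma minimal_left_ideal_Theta_maximal L :
  minimal_left_ideal L -> Theta_maximal (bigcap_ultra L).
Proof.
move=> Lm; split; first exact/bigcap_ultra_proper/Lm.1.1.
  exact/left_ideal_thick/Lm.1.
move=> G GF [LG nGL]; apply: contrapT => nG; apply: nGL.
have Gthick : G `<=` @thick S.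
  by move=> A GA; apply: contrapT => nA; apply: nG; exists A.
have [L' L'm L'G] := thick_filter_ideal _ GF Gthick.
suff <- : L' = L by move=> A GA q L'q; exact: L'G.
apply: Lm.2; first exact: L'm.1.
move=> q /L'G Gq; apply: (minimal_left_ideal_closed _ Lm) => A LA.
exact/Gq/LG.
Qed.

Lemma Theta_maximal_minimal_left_ideal (F : set_system S) : Theta_maximal F ->
  exists2 L, minimal_left_ideal L & F = bigcap_ultra L.
Proof.
move=> [FF Fthick Fmax]; have [L Lm LF] := thick_filter_ideal _ FF Fthick.
exists L => //; apply: contrapT => nE.
have FL : F `<=` bigcap_ultra L by move=> A FA q /LF; exact.
have [||A LA] := Fmax (bigcap_ultra L).
- exact/bigcap_ultra_proper/Lm.1.1.
- by split=> // LF'; apply: nE; apply/seteqP; split.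
- by apply; exact: (left_ideal_thick _ Lm.1).
Qed.

Lemma Theta_maximal_sub_unique (F : set_system S) L p :
  minimal_left_ideal L -> L p -> Theta_maximal F -> F `<=` usets p ->
  F = bigcap_ultra L.
Proof.
move=> Lm Lp /Theta_maximal_minimal_left_ideal [L' L'm ->] L'p.
have L'p' : L' p := minimal_left_ideal_closed _ L'm _ L'p.
by rewrite (minimal_left_ideal_unique _ _ _ L'm Lm L'p' Lp).
Qed.

(** Here [L] is the left ideal generated by [p], and a set that belongs to every
ultrafilter on [S] is all of [S]. *)
Lemma bigcap_minimal_left_ideal L p : minimal_left_ideal L -> L p ->
  bigcap_ultra L =
  [set A | usets p A /\ forall s : S, usets p (lquot s A)].
Proof.
move=> Lm Lp; apply/seteqP; split=> A.
  move=> LA; split=> [|s]; first exact: LA.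
  by apply/principalM; apply: LA; exact: Lm.1.2.
move=> [_ pA] q; rewrite -(minimal_left_idealM _ _ Lm Lp) => -[t _ <-].
rewrite usetsM; apply: filterS (filterT : usets t setT) => s _.
exact: pA.
Qed.

(** * Syndetic sets and transversals of the minimal left ideals *)

Lemma syndeticP (A : set S) : syndetic A <-> ~ thick (~` A).
Proof.
split=> [[F [Ff Fn FA]] /(_ F Ff Fn) [x xA]|].
  have : [set: S] x by [].
  by rewrite FA => -[s Fs As]; apply: (xA (s * x)%g) As; exists s.
move=> nA; apply: contrapT => nS; apply: nA => F Ff Fn.
apply: contrapT => nx; apply: nS; exists F; split=> //.
apply/seteqP; split=> // x _; apply: contrapT => h; apply: nx.
by exists x => _ [s Fs <-] As; apply: h; exists s.
Qed.

Lemma syndetic_meets J A : left_ideal J -> syndetic A ->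
  exists2 q, J q & usets q A.
Proof.
move=> JI /syndeticP nA.
have [/(left_ideal_thick _ JI)//|q Jq] := @bigcap_ultraN S J (~` A).
by rewrite setCK; exists q.
Qed.

Lemma meets_syndetic A : [set: S] !=set0 ->
  (forall L, minimal_left_ideal L -> exists2 q, L q & usets q A) -> syndetic A.
Proof.
move=> [s0 _] LA; apply/syndeticP => Ath.
have [x0 x0A] := Ath [set s0] (finite_set1 s0) (ex_intro _ s0 erefl).
have AP : ProperFilter (globally (~` A)).
  by apply: globally_properfilter (s0 * x0)%g _; apply: x0A; exists s0.
have [B AB F Ff Fn|L Lm LH] := thick_filter_ideal _ AP.
  by have [x xA] := Ath F Ff Fn; exists x => y /xA; exact: AB.
have [q Lq qA] := LA L Lm; apply: (ultra_disjoint _ _ qA).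
by apply: LH.
Qed.

(** If [e] is an idempotent of [R], then [f * e = e] for all idempotents [f] of
[R], so right translation by [e] is constant, equal to [p * e], on [p * E(R)],
and by continuity on its closure. *)
Lemma closure_transversal_mulr R e p r :
  minimal_right_ideal R -> idempotents R e ->
  hull (bigcap_ultra [set (p * f)%g | f in idempotents R]) r ->
  (r * e)%g = (p * e)%g.
Proof.
move=> Rm eR h; apply/esym/usets_sub_eq => A peA; rewrite usetsM.
apply: h => _ [f fR <-].
have := peA; rewrite -{1}(idempotent_left_unit _ _ _ Rm fR eR.1).
by rewrite mulgA usetsM.
Qed.

(** A minimal left ideal [L] meets the closure of [p * E(R)] in the single
point [p * e], where [e] is the idempotent of [R] in [L]. *)
Lemma closure_transversal_meet R L e p r :
  minimal_right_ideal R -> minimal_left_ideal L ->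
  idempotents R e -> L e -> L r ->
  hull (bigcap_ultra [set (p * f)%g | f in idempotents R]) r ->
  r = (p * e)%g.
Proof.
move=> Rm Lm eR Le Lr h.
rewrite -(closure_transversal_mulr _ _ _ _ Rm eR h).
by rewrite (idempotent_right_unit _ _ _ Lm (conj Le eR.2) Lr).
Qed.

Lemma right_ideal_idempotent R L : right_ideal R -> minimal_left_ideal L ->
  exists2 e, idempotents R e & L e.
Proof.
move=> RI Lm; have [e eL] := minimal_left_ideal_idempotent _ Lm.
exact: idempotent_in_meet RI Lm eL.
Qed.

(** The set [p * E(R)] meets every minimal left ideal, which gives syndeticity.
A larger filter of syndetic sets has, in the minimal left ideal [L] of each
idempotent [e] of [R], an ultrafilter above it; that can only be [p * e]. *)
Lemma transversal_Sigma_maximal R p :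
  minimal_right_ideal R ->
  (forall x, R x -> exists2 L, minimal_left_ideal L & L x) ->
  Sigma_maximal (bigcap_ultra [set (p * e)%g | e in idempotents R]).
Proof.
move=> Rm RK.
have [x Rx] := Rm.1.1; have [L0 L0m _] := RK x Rx.
have [e0 e0R _] := right_ideal_idempotent _ _ Rm.1 L0m.
have Sn : [set: S] !=set0.
  by apply: (@filter_ex _ (usets p)); exact: filterT.
split.
- by apply: bigcap_ultra_proper; exists (p * e0)%g, e0.
- move=> A EA; apply: meets_syndetic => // L Lm.
  have [e eR Le] := right_ideal_idempotent _ _ Rm.1 Lm.
  exists (p * e)%g; first exact: Lm.1.2.
  by apply: EA; exists e.
move=> G GF [EG nGE]; apply: contrapT => nG; apply: nGE => A GA _ [e eR <-].
have Gsynd B : G B -> syndetic B.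
  by move=> GB; apply: contrapT => nB; apply: nG; exists B.
have [L Lm Le] := RK e eR.1.
have [||r Lr Gr] := @hull_meet S (bigcap_ultra L) G.
- exact: bigcap_ultra_filter.
- move=> B C LB GC; have [q Lq qC] := syndetic_meets _ _ Lm.1 (Gsynd _ GC).
  by apply: (@filter_ex _ (usets q)); apply: filterI => //; exact: LB.
rewrite -(closure_transversal_meet _ _ _ _ r Rm Lm eR Le); first exact: Gr.
  exact: (minimal_left_ideal_closed _ Lm).
by move=> B EB; exact/Gr/EG.
Qed.

Lemma generates_meet (F G : set_system S) p :
  hull F p -> hull G p -> (forall q, hull F q -> hull G q -> q = p) ->
  generates (F `|` G) p.
Proof.
move=> Fp Gp uniq; apply/seteqP; split=> [A pA H [HF FGH]|].
  apply: filter_hull => q Hq; rewrite (uniq q) // => B ?; apply: Hq.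
  - by apply: FGH; left.
  - by apply: FGH; right.
have pF : Filter (usets p) by exact: filter_filter.
apply: smallest_sub => //.
by move=> A [/Fp|/Gp].
Qed.

End BetaSemigroup.

Theorem theorem2p7 (S : semigroupType) (infS : infinite_set [set: S])
    (p : beta S) (minp : minimal_ultrafilter p) :
  (exists F G : set_system S,
     [/\ Theta_maximal F, Sigma_maximal G & generates (F `|` G) p]) /\
  exists L R : set (beta S),
    [/\ unique (fun I => minimal_left_ideal I /\ I p) L,
        unique (fun I => minimal_right_ideal I /\ I p) R &
        let F := bigcap_ultra L in
        let G := bigcap_ultra [set (p * e)%g | e in idempotents R] in
        [/\ Theta_maximal F, Sigma_maximal G, generates (F `|` G) p,
            (forall F' : set_system S,
               Theta_maximal F' -> F' `<=` usets p -> F' = F) &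
            F = [set A | usets p A /\ forall s : S, usets p (lquot s A)]]].
Proof.
have [L Lm Lp] : exists2 L, minimal_left_ideal L & L p.
  apply: smallest_ideal_minimal_left minp.
  have [L [Lm _ _]] := exists_minimal_left_ideal _ (left_idealT p).
  by exists L.
have [e0 e0L] := minimal_left_ideal_idempotent _ Lm.
pose R := [set (p * y)%g | y in [set: beta S]].
have Rm : minimal_right_ideal R := minimal_right_ideal_mem _ _ _ Lm e0L Lp.
have Rp : R p by exists e0 => //; exact: idempotent_right_unit Lm e0L Lp.
have [e eR Le] := right_ideal_idempotent _ _ Rm.1 Lm.
have pe : (p * e)%g = p := idempotent_right_unit _ _ _ Lm (conj Le eR.2) Lp.
have FT := minimal_left_ideal_Theta_maximal _ Lm.
have GS : Sigma_maximal (bigcap_ultra [set (p * f)%g | f in idempotents R]).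
  apply: transversal_Sigma_maximal => // _ [y _ <-].
  by apply: minimal_left_idealsM; exists L.
have gen : generates (bigcap_ultra L `|`
    bigcap_ultra [set (p * f)%g | f in idempotents R]) p.
  apply: generates_meet => [A|A|q Lq Gq]; first exact.
    by apply; exists e.
  rewrite -[RHS]pe; apply: (closure_transversal_meet R L) => //.
  exact: (minimal_left_ideal_closed _ Lm _ Lq).
split.
  by exists (bigcap_ultra L),
    (bigcap_ultra [set (p * f)%g | f in idempotents R]).
exists L, R; split.
- split=> // L' [L'm L'p]; exact: minimal_left_ideal_unique Lm L'm Lp L'p.
- split=> // R' [R'm R'p]; exact: minimal_right_ideal_unique Rm R'm Rp R'p.
split=> // [F' F'T F'p|].
- exact: Theta_maximal_sub_unique Lm Lp F'T F'p.
- exact: bigcap_minimal_left_ideal.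
Qed.
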